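(* Let $\Phi\subseteq\{I,O,U,\mathit{Self},Q_n,N_n\mid n\in\mathbb N\setminus\{0\}\}$ and let $\mathcal A$ be a fuzzy ABox in $\mathcal L^{\sim}_\Phi$. Suppose that $O\in\Phi$ or that $\mathcal A$ consists only of fuzzy assertions of the form $C(a)\bowtie p$. Then for all fuzzy interpretations $\mathcal I$ and $\mathcal I'$ that are witnessed w.r.t. $\mathcal L^{\sim}_\Phi$ and strongly $\Phi$-bisimilar to each other, $\mathcal I\models\mathcal A$ iff $\mathcal I'\models\mathcal A$.
   Context: Gödel operations on $[0,1]$: $p\otimes q=\min\{p,q\}$, $p\oplus q=\max\{p,q\}$, $\ominus p=1$ if $p=0$ and $0$ otherwise, $(p\Rightarrow q)=1$ if $p\le q$ and $q$ otherwise, $(p\Leftrightarrow q)=(p\Rightarrow q)\otimes(q\Rightarrow p)$. Fix pairwise disjoint sets $\mathsf{CN}$, $\mathsf{RN}$, $\mathsf{IN}$ of concept, role and individual names. A basic role w.r.t. $\Phi$ is $r\in\mathsf{RN}$, or $r^-$ when $I\in\Phi$. Roles and concepts of $\mathcal L^{\sim}_\Phi$: each $r\in\mathsf{RN}$ is a role; if $R,S$ are roles and $C$ a concept then $R\circ S$, $R\sqcup S$, $R^*$, $C?$ are roles; $R^-$ if $I\in\Phi$; $U$ if $U\in\Phi$; concepts: $p\in[0,1]$, $A\in\mathsf{CN}$, $C\sqcap D$, $C\to D$, $\neg C$, $C\sqcup D$, $\mathord{\sim}C$, $\forall R.C$, $\exists R.C$; $\{a\}$ if $O\in\Phi$; $\exists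 r.\mathit{Self}$ if $\mathit{Self}\in\Phi$; ${\ge}n\,R.C$, ${<}n\,R.C$ for basic $R$ if $Q_n\in\Phi$; ${\ge}n\,R$, ${<}n\,R$ for basic $R$ if $N_n\in\Phi$. $\top$ is concept $1$. A fuzzy interpretation $\mathcal I$ has a nonempty domain $\Delta^{\mathcal I}$, $a^{\mathcal I}\in\Delta^{\mathcal I}$, $A^{\mathcal I}:\Delta^{\mathcal I}\to[0,1]$, $r^{\mathcal I}:(\Delta^{\mathcal I})^2\to[0,1]$, extended by: $U^{\mathcal I}\equiv1$; $(R^-)^{\mathcal I}(x,y)=R^{\mathcal I}(y,x)$; $(C?)^{\mathcal I}(x,y)=C^{\mathcal I}(x)$ if $x=y$, else $0$; $(R\circ S)^{\mathcal I}(x,y)=\sup_z R^{\mathcal I}(x,z)\otimes S^{\mathcal I}(z,y)$; $(R\sqcup S)^{\mathcal I}=R^{\mathcal I}\oplus S^{\mathcal I}$; $(R^* )^{\mathcal I}(x,y)=\sup\{\min(\{1\}\cup\{R^{\mathcal I}(x_i,x_{i+1})\mid i<n\})\mid n\ge0,x_0=x,x_n=y\}$; $p^{\mathcal I}(x)=p$; $\{a\}^{\mathcal I}(x)=1$ iff $x=a^{\mathcal I}$, else $0$; $(\neg C)^{\mathcal I}=\ominus C^{\mathcal I}$; $(\mathord{\sim}C)^{\mathcal I}(x)=1-C^{\mathcal I}(x)$; $\sqcap,\sqcup,\to$ pointwise by $\otimes,\oplus,\Rightarrow$; $(\exists r.\mathit{Self})^{\mathcal I}(x)=r^{\mathcal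 I}(x,x)$; $(\exists R.C)^{\mathcal I}(x)=\sup_y R^{\mathcal I}(x,y)\otimes C^{\mathcal I}(y)$; $(\forall R.C)^{\mathcal I}(x)=\inf_y(R^{\mathcal I}(x,y)\Rightarrow C^{\mathcal I}(y))$; $({\ge}n\,R.C)^{\mathcal I}(x)=\sup\{\min_i(R^{\mathcal I}(x,y_i)\otimes C^{\mathcal I}(y_i))\mid y_1..y_n$ pairwise distinct$\}$; $({<}n\,R.C)^{\mathcal I}(x)=\inf\{\min_i(R^{\mathcal I}(x,y_i)\otimes C^{\mathcal I}(y_i))\Rightarrow e\mid y_1..y_n\}$ with $e=1$ if some $y_j=y_k$ ($j<k$), else $0$; ${\ge}n\,R={\ge}n\,R.\top$, ${<}n\,R={<}n\,R.\top$. Witnessed w.r.t. $\mathcal L^{\sim}_\Phi$: for roles/concepts of $\mathcal L^{\sim}_\Phi$, every infinite set whose infimum (supremum) is taken above has a least (greatest) element. A fuzzy assertion in $\mathcal L^{\sim}_\Phi$ is $a\doteq b$, $a\not\doteq b$, $C(a)\bowtie p$ or $R(a,b)\bowtie p$ ($a,b\in\mathsf{IN}$, $C$ a concept and $R$ a role of $\mathcal L^{\sim}_\Phi$, $\bowtie\in\{\ge,>,\le,<\}$, $p\in[0,1]$), validated by $\mathcal I$ iff respectively $a^{\mathcal I}=b^{\mathcal I}$, $a^{\mathcal I}\ne b^{\mathcal I}$, $C^{\mathcal I}(a^{\mathcal I})\bowtie p$, $R^{\mathcal I}(a^{\mathcal I},b^{\mathcal I})\bowtie p$. A fuzzy ABox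 is a finite set of fuzzy assertions; $\mathcal I\models\mathcal A$ iff $\mathcal I$ validates all of them. A crisp $\Phi$-bisimulation between $\mathcal I,\mathcal I'$ is $Z:\Delta^{\mathcal I}\times\Delta^{\mathcal I'}\to\{0,1\}$ such that, for all $x,x',A,a,r$ and basic $R$: (i) $Z(x,x')\le(A^{\mathcal I}(x)\Leftrightarrow A^{\mathcal I'}(x'))$; (ii) $\forall y\exists y'$: $Z(x,x')\otimes R^{\mathcal I}(x,y)\le Z(y,y')\otimes R^{\mathcal I'}(x',y')$; (iii) $\forall y'\exists y$: $Z(x,x')\otimes R^{\mathcal I'}(x',y')\le Z(y,y')\otimes R^{\mathcal I}(x,y)$; (iv) if $O\in\Phi$: $Z(x,x')=0$ whenever exactly one of $x=a^{\mathcal I}$, $x'=a^{\mathcal I'}$ holds; (v) if $U\in\Phi$: $\forall y\exists y'$ $Z(x,x')\le Z(y,y')$ and $\forall y'\exists y$ $Z(x,x')\le Z(y,y')$; (vi) if $\mathit{Self}\in\Phi$: $Z(x,x')\le(r^{\mathcal I}(x,x)\Leftrightarrow r^{\mathcal I'}(x',x'))$; (vii) if $Q_n\in\Phi$: if $Z(x,x')>0$ and $y_1..y_n$ pairwise distinct with all $R^{\mathcal I}(x,y_j)>0$, there exist pairwise distinct $y'_1..y'_n$ such that for each $i$ some $j$ has $Z(x,x')\otimes\bigotimes_k R^{\mathcal I}(x,y_k)\le Z(y_j,y'_i)\otimes R^{\mathcal I'}(x',y'_i)$, and symmetrically (from pairwise distinct $y'_1..y'_n$ with $R^{\mathcal I'}(x',y'_j)>0$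 obtain pairwise distinct $y_1..y_n$ such that for each $i$ some $j$ has $Z(x,x')\otimes\bigotimes_k R^{\mathcal I'}(x',y'_k)\le Z(y_i,y'_j)\otimes R^{\mathcal I}(x,y_i)$); (viii) if $N_n\in\Phi$: as (vii) with right-hand sides $R^{\mathcal I'}(x',y'_i)$ for all $i$, resp. $R^{\mathcal I}(x,y_i)$ for all $i$. $\mathcal I$ and $\mathcal I'$ are strongly $\Phi$-bisimilar if $\mathsf{IN}\ne\emptyset$ and there is a crisp $\Phi$-bisimulation $Z$ between them with $Z(a^{\mathcal I},a^{\mathcal I'})=1$ for all $a\in\mathsf{IN}$. *)

(* Defs.v *)
From mathcomp Require Import all_boot all_order all_algebra.
From mathcomp Require Import all_classical all_reals.

Set Implicit Arguments.
Unset Strict Implicit.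
Unset Printing Implicit Defensive.

Import Order.TTheory GRing.Theory Num.Theory.
Local Open Scope classical_set_scope.
Local Open Scope ring_scope.

Section GoedelOperators.
Variable K : realType.
Implicit Types p q : K.

Definition god_and p q : K := Num.min p q.
Definition god_or p q : K := Num.max p q.
Definition god_neg p : K := if p == 0 then 1 else 0.
Definition god_imp p q : K := if p <= q then 1 else q.
Definition god_iff p q : K := god_and (god_imp p q) (god_imp q p).

(* The unit 1 makes this min({1} `|` {f i | i < n}), which for n > 0 and
   values in [0,1] is the plain minimum of the f i. *)
Definition god_bigand (n : nat) (f : 'I_n -> K) : K :=
  \big[god_and/1]_(i < n) f i.

End GoedelOperators.

Inductive feature : Type :=
  | feat_I | feat_O | feat_U | feat_Self
  | feat_Q (n : nat) | feat_N (n : nat).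

Definition features : set feature :=
  [set f | match f with feat_Q n | feat_N n => (0 < n)%N | _ => True end].

Section Syntax.
Variables (K : realType) (CN RN IN : Type) (Phi : set feature).

Inductive basic_role : Type :=
  | BName (r : RN)
  | BInv of Phi feat_I & RN.

(* These types contain exactly the roles and concepts of the language
   determined by Phi: constructors that depend on a feature require a proof
   that it belongs to Phi. *)
Inductive role : Type :=
  | RName (r : RN)
  | RComp (R S : role)
  | RUnion (R S : role)
  | RStar (R : role)
  | RTest (C : concept)
  | RInv of Phi feat_I & role
  | RUniv of Phi feat_U
with concept : Type :=
  | CConst (p : K) of 0 <= p <= 1
  | CName (A : CN)
  | CAnd (C D : concept)
  | CImp (C D : concept)
  | CNeg (C : concept)
  | COr (C D : concept)
  | CInvol (C : concept)
  | CForall (R : role) (C : concept)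
  | CExists (R : role) (C : concept)
  | CNominal of Phi feat_O & IN
  | CSelf of Phi feat_Self & RN
  | CGeQ (n : nat) of Phi (feat_Q n) & basic_role & concept
  | CLtQ (n : nat) of Phi (feat_Q n) & basic_role & concept
  | CGeN (n : nat) of Phi (feat_N n) & basic_role
  | CLtN (n : nat) of Phi (feat_N n) & basic_role.

Inductive cmp : Type := Ge | Gt | Le | Lt.

Inductive assertion : Type :=
  | AEq (a b : IN)
  | ANeq (a b : IN)
  | AConcept (C : concept) (a : IN) (c : cmp) (p : K) of 0 <= p <= 1
  | ARole (R : role) (a b : IN) (c : cmp) (p : K) of 0 <= p <= 1.

Definition is_concept_assertion (phi : assertion) : Prop :=
  match phi with AConcept _ _ _ _ _ => True | _ => False end.

End Syntax.

Record interp (K : realType) (CN RN IN : Type) : Type := Interp {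
  dom : Type;
  dom_nonempty : inhabited dom;
  indI : IN -> dom;
  cnameI : CN -> dom -> K;
  rnameI : RN -> dom -> dom -> K;
  cnameI01 : forall A x, 0 <= cnameI A x <= 1;
  rnameI01 : forall r x y, 0 <= rnameI r x y <= 1
}.

(* The sets of values whose suprema or infima interpret the constructors. *)
Section ValueSets.
Variables (K : realType) (D : Type).
Implicit Types (F G : D -> D -> K) (H : D -> K).

Definition comp_values F G (x y : D) : set K :=
  [set v | exists z, v = god_and (F x z) (G z y)].

Definition star_values F (x y : D) : set K :=
  [set v | exists (n : nat) (u : nat -> D),
     [/\ u 0%N = x, u n = y &
         v = god_bigand (fun i : 'I_n => F (u i) (u i.+1))]].

Definition exists_values F H (x : D) : set K :=
  [set v | exists y, v = god_and (F x y) (H y)].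

Definition forall_values F H (x : D) : set K :=
  [set v | exists y, v = god_imp (F x y) (H y)].

Definition ge_values (n : nat) F H (x : D) : set K :=
  [set v | exists y : 'I_n -> D, injective y /\
     v = god_bigand (fun i => god_and (F x (y i)) (H (y i)))].

Definition has_repetition (n : nat) (y : 'I_n -> D) : Prop :=
  exists j k : 'I_n, (j < k)%N /\ y j = y k.

Definition lt_values (n : nat) F H (x : D) : set K :=
  [set v | exists y : 'I_n -> D,
     v = god_imp (god_bigand (fun i => god_and (F x (y i)) (H (y i))))
                 (if `[< has_repetition y >] then 1 else 0)].

End ValueSets.

Section Semantics.
Variables (K : realType) (CN RN IN : Type) (Phi : set feature).
Variable I : interp K CN RN IN.
Notation D := (dom I).

Definition basicI (R : basic_role RN Phi) (x y : D) : K :=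
  match R with
  | BName r => rnameI r x y
  | BInv _ r => rnameI r y x
  end.

(* [sup set0 = 0] in the library, which is also the supremum of the empty set
   in [0,1]; only [ge_values] can be empty. The sets under [inf] are never
   empty. [fun _ => 1] is the interpretation of the top concept. *)
Fixpoint roleI (R : role K CN RN IN Phi) : D -> D -> K :=
  match R with
  | RName r => rnameI r
  | RComp R1 R2 => fun x y => sup (comp_values (roleI R1) (roleI R2) x y)
  | RUnion R1 R2 => fun x y => god_or (roleI R1 x y) (roleI R2 x y)
  | RStar R => fun x y => sup (star_values (roleI R) x y)
  | RTest C => fun x y => if `[< x = y >] then conceptI C x else 0
  | RInv _ R => fun x y => roleI R y x
  | RUniv _ => fun _ _ => 1
  end
with conceptI (C : concept K CN RN IN Phi) : D -> K :=
  match C with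
  | CConst p _ => fun _ => p
  | CName A => cnameI A
  | CAnd C1 C2 => fun x => god_and (conceptI C1 x) (conceptI C2 x)
  | CImp C1 C2 => fun x => god_imp (conceptI C1 x) (conceptI C2 x)
  | CNeg C1 => fun x => god_neg (conceptI C1 x)
  | COr C1 C2 => fun x => god_or (conceptI C1 x) (conceptI C2 x)
  | CInvol C1 => fun x => 1 - conceptI C1 x
  | CForall R C1 => fun x => inf (forall_values (roleI R) (conceptI C1) x)
  | CExists R C1 => fun x => sup (exists_values (roleI R) (conceptI C1) x)
  | CNominal _ a => fun x => if `[< x = indI I a >] then 1 else 0
  | CSelf _ r => fun x => rnameI r x x
  | CGeQ n _ R C1 => fun x => sup (ge_values n (basicI R) (conceptI C1) x)
  | CLtQ n _ R C1 => fun x => inf (lt_values n (basicI R) (conceptI C1) x)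
  | CGeN n _ R => fun x => sup (ge_values n (basicI R) (fun _ => 1) x)
  | CLtN n _ R => fun x => inf (lt_values n (basicI R) (fun _ => 1) x)
  end.

Definition has_greatest (S : set K) : Prop := exists2 m, S m & ubound S m.
Definition has_least (S : set K) : Prop := exists2 m, S m & lbound S m.

Definition sup_witnessed (S : set K) : Prop := infinite_set S -> has_greatest S.
Definition inf_witnessed (S : set K) : Prop := infinite_set S -> has_least S.

Record witnessed : Prop := Witnessed {
  wit_comp : forall (R S : role K CN RN IN Phi) x y,
    sup_witnessed (comp_values (roleI R) (roleI S) x y);
  wit_star : forall (R : role K CN RN IN Phi) x y,
    sup_witnessed (star_values (roleI R) x y);
  wit_exists : forall (R : role K CN RN IN Phi) (C : concept K CN RN IN Phi) x,
    sup_witnessed (exists_values (roleI R) (conceptI C) x);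
  wit_forall : forall (R : role K CN RN IN Phi) (C : concept K CN RN IN Phi) x,
    inf_witnessed (forall_values (roleI R) (conceptI C) x);
  wit_geQ : forall n (R : basic_role RN Phi) (C : concept K CN RN IN Phi) x,
    Phi (feat_Q n) -> sup_witnessed (ge_values n (basicI R) (conceptI C) x);
  wit_ltQ : forall n (R : basic_role RN Phi) (C : concept K CN RN IN Phi) x,
    Phi (feat_Q n) -> inf_witnessed (lt_values n (basicI R) (conceptI C) x);
  wit_geN : forall n (R : basic_role RN Phi) x,
    Phi (feat_N n) -> sup_witnessed (ge_values n (basicI R) (fun _ => 1) x);
  wit_ltN : forall n (R : basic_role RN Phi) x,
    Phi (feat_N n) -> inf_witnessed (lt_values n (basicI R) (fun _ => 1) x)
}.

Definition cmpP (c : cmp) (v p : K) : Prop :=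
  match c with Ge => v >= p | Gt => v > p | Le => v <= p | Lt => v < p end.

Definition validates (phi : assertion K CN RN IN Phi) : Prop :=
  match phi with
  | AEq a b => indI I a = indI I b
  | ANeq a b => indI I a <> indI I b
  | AConcept C a c p _ => cmpP c (conceptI C (indI I a)) p
  | ARole R a b c p _ => cmpP c (roleI R (indI I a) (indI I b)) p
  end.

End Semantics.

Record fuzzy_abox (K : realType) (CN RN IN : Type) (Phi : set feature) : Type :=
  FuzzyABox {
    abox_set :> set (assertion K CN RN IN Phi);
    abox_finite : finite_set abox_set
  }.

Definition models (K : realType) (CN RN IN : Type) (Phi : set feature)
    (I : interp K CN RN IN) (A : fuzzy_abox K CN RN IN Phi) : Prop :=
  forall phi, abox_set A phi -> validates I phi.

Section Bisimulation.
Variables (K : realType) (CN RN IN : Type) (Phi : set feature).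
Variables (I I' : interp K CN RN IN).

(* A {0,1}-valued relation is boolean-valued; [(Z x x')%:R] is its value in K. *)
Record crisp_bisimulation (Z : dom I -> dom I' -> bool) : Prop :=
  CrispBisimulation {
  bis_name : forall x x' (A : CN),
    (Z x x')%:R <= god_iff (cnameI A x) (cnameI A x') :> K;
  bis_forth : forall x x' (R : basic_role RN Phi) y, exists y',
    god_and (Z x x')%:R (basicI R x y)
      <= god_and (Z y y')%:R (basicI R x' y');
  bis_back : forall x x' (R : basic_role RN Phi) y', exists y,
    god_and (Z x x')%:R (basicI R x' y')
      <= god_and (Z y y')%:R (basicI R x y);
  bis_O : Phi feat_O -> forall x x' (a : IN),
    (x = indI I a /\ x' <> indI I' a) \/ (x <> indI I a /\ x' = indI I' a) ->
    Z x x' = false;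
  bis_U_forth : Phi feat_U -> forall x x' y, exists y',
    (Z x x')%:R <= (Z y y')%:R :> K;
  bis_U_back : Phi feat_U -> forall x x' y', exists y,
    (Z x x')%:R <= (Z y y')%:R :> K;
  bis_Self : Phi feat_Self -> forall x x' (r : RN),
    (Z x x')%:R <= god_iff (rnameI r x x) (rnameI r x' x') :> K;
  bis_Q_forth : forall n, Phi (feat_Q n) ->
    forall x x' (R : basic_role RN Phi) (y : 'I_n -> dom I),
    Z x x' -> injective y -> (forall j, 0 < basicI R x (y j)) ->
    exists y' : 'I_n -> dom I', injective y' /\
      forall i, exists j,
        god_and (Z x x')%:R (god_bigand (fun k => basicI R x (y k)))
          <= god_and (Z (y j) (y' i))%:R (basicI R x' (y' i));
  bis_Q_back : forall n, Phi (feat_Q n) ->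
    forall x x' (R : basic_role RN Phi) (y' : 'I_n -> dom I'),
    Z x x' -> injective y' -> (forall j, 0 < basicI R x' (y' j)) ->
    exists y : 'I_n -> dom I, injective y /\
      forall i, exists j,
        god_and (Z x x')%:R (god_bigand (fun k => basicI R x' (y' k)))
          <= god_and (Z (y i) (y' j))%:R (basicI R x (y i));
  bis_N_forth : forall n, Phi (feat_N n) ->
    forall x x' (R : basic_role RN Phi) (y : 'I_n -> dom I),
    Z x x' -> injective y -> (forall j, 0 < basicI R x (y j)) ->
    exists y' : 'I_n -> dom I', injective y' /\
      forall i,
        god_and (Z x x')%:R (god_bigand (fun k => basicI R x (y k)))
          <= basicI R x' (y' i);
  bis_N_back : forall n, Phi (feat_N n) ->
    forall x x' (R : basic_role RN Phi) (y' : 'I_n -> dom I'),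
    Z x x' -> injective y' -> (forall j, 0 < basicI R x' (y' j)) ->
    exists y : 'I_n -> dom I, injective y /\
      forall i,
        god_and (Z x x')%:R (god_bigand (fun k => basicI R x' (y' k)))
          <= basicI R x (y i)
}.

Definition strongly_bisimilar : Prop :=
  inhabited IN /\
  exists2 Z : dom I -> dom I' -> bool,
    crisp_bisimulation Z & forall a : IN, Z (indI I a) (indI I' a).

End Bisimulation.

(* Main.v *)
(* Along a witnessed bisimulation Z, by mutual induction on the syntax:
   concepts take equal values at Z-related points, and a positive value
   R(x, y) is matched from any x' with Z(x, x') by some y' with Z(y, y') and
   R(x, y) <= R'(x', y'). Restricting to positive values is necessary: condition
   (ii) asserts nothing when R(x, y) = 0. Both claims are made for all pairs of
   interpretations at once, so that Z may be replaced by its converse, and for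
   R together with its transpose, since inversion applies to complex roles.
   Witnessedness is only used to split compositions and iterations, whose
   suprema are then attained. With nominals, Z relates the interpretation of
   each individual name only to the other interpretation of that name, which
   transfers equalities and role assertions. *)

Require Import Defs.
From mathcomp Require Import all_boot all_order all_algebra.
From mathcomp Require Import all_classical all_reals.

Local Open Scope classical_set_scope.

Set Implicit Arguments.
Unset Strict Implicit.
Unset Printing Implicit Defensive.

Import Order.TTheory GRing.Theory Num.Theory.

Local Open Scope ring_scope.

Local Arguments basicI {K CN RN IN Phi} I R x y.
Local Arguments roleI {K CN RN IN Phi} I R x y.
Local Arguments conceptI {K CN RN IN Phi} I C x.

(** * Gödel operations, suprema and infima in the unit interval *)

Section UnitInterval.
Variable K : realType.
Implicit Types (p q v : K) (S : set K).

Lemma unit_and p q : 0 <= p <= 1 -> 0 <= q <= 1 -> 0 <= god_and p q <= 1.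
Proof. by rewrite /god_and; case: (leP p q). Qed.

Lemma unit_or p q : 0 <= p <= 1 -> 0 <= q <= 1 -> 0 <= god_or p q <= 1.
Proof. by rewrite /god_or; case: (leP p q). Qed.

Lemma unit_imp p q : 0 <= q <= 1 -> 0 <= god_imp p q <= 1.
Proof. by rewrite /god_imp; case: ifP => // _ _; rewrite ler01 lexx. Qed.

Lemma unit_neg p : 0 <= god_neg p <= 1.
Proof. by rewrite /god_neg; case: ifP; rewrite ler01 lexx. Qed.

Lemma unit_onem p : 0 <= p <= 1 -> 0 <= 1 - p <= 1.
Proof. by case/andP=> p0 p1; rewrite subr_ge0 p1 gerBl p0. Qed.

Lemma le_bigand n (f : 'I_n -> K) v :
  v <= 1 -> (forall i, v <= f i) -> v <= god_bigand f.
Proof. by move=> v1 vf; apply/le_bigmin. Qed.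

Lemma bigand_le n (f : 'I_n -> K) i : god_bigand f <= f i.
Proof. exact: bigmin_le. Qed.

Lemma bigand_le1 n (f : 'I_n -> K) : god_bigand f <= 1.
Proof. exact: bigmin_le_id. Qed.

(** Reindexing along [h] can drop entries from the minimum but adds none. *)
Lemma bigand_le_comp m n (f : 'I_n -> K) (h : 'I_m -> 'I_n) :
  god_bigand f <= god_bigand (fun i => f (h i)).
Proof. by apply: le_bigand => [|i]; [exact: bigand_le1 | exact: bigand_le]. Qed.

Lemma unit_bigand n (f : 'I_n -> K) :
  (forall i, 0 <= f i <= 1) -> 0 <= god_bigand f <= 1.
Proof.
move=> f01; rewrite bigand_le1 le_bigand ?ler01 // => i.
by case/andP: (f01 i).
Qed.

Lemma unit_sup S : (forall v, S v -> 0 <= v <= 1) -> 0 <= sup S <= 1.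
Proof.
move=> S01; have [->|/set0P[v Sv]] := eqVneq S set0.
  by rewrite sup0 lexx ler01.
have ubS : ubound S 1 by move=> w /S01 /andP[].
apply/andP; split; last by apply: ge_sup => //; exists v.
have /andP[v0 _] := S01 _ Sv.
by apply: le_trans v0 _; apply: ub_le_sup => //; exists 1.
Qed.

Lemma unit_inf S : (forall v, S v -> 0 <= v <= 1) -> 0 <= inf S <= 1.
Proof.
move=> S01; have [->|/set0P[v Sv]] := eqVneq S set0.
  by rewrite inf0 lexx ler01.
have lbS : lbound S 0 by move=> w /S01 /andP[].
apply/andP; split; first by apply: lb_le_inf => //; exists v.
have /andP[_ v1] := S01 _ Sv.
by apply: le_trans v1; apply: ge_inf => //; exists 0.
Qed.

Lemma unit_le_sup S v : (forall w, S w -> 0 <= w <= 1) -> S v -> v <= sup S.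
Proof.
by move=> S01 Sv; apply: ub_le_sup => //; exists 1 => w /S01 /andP[].
Qed.

Lemma unit_inf_le S v : (forall w, S w -> 0 <= w <= 1) -> S v -> inf S <= v.
Proof.
by move=> S01 Sv; apply: ge_inf => //; exists 0 => w /S01 /andP[].
Qed.

Lemma finite_has_greatest S : finite_set S -> S !=set0 -> has_greatest S.
Proof.
case/finite_seqP => s ->; elim: s => [|a s IH] [v] //= _.
have [s0|] := pselect ([set` s] !=set0); last first.
  move=> s0; exists a; first by rewrite /= mem_head.
  move=> w /=; rewrite inE => /predU1P[->//|ws].
  by case: s0; exists w.
have [m ms mub] := IH s0.
exists (Num.max a m).
  by case: (leP a m) => _; rewrite /= inE ?eqxx //; rewrite (ms : m \in s) orbT.
move=> w /=; rewrite inE => /predU1P[->|ws]; first by rewrite le_max lexx.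
by rewrite le_max mub ?orbT.
Qed.

(** Witnessedness speaks of infinite sets; a finite nonempty set has a greatest element in any case.
    That element is the supremum. *)
Lemma sup_witnessed_mem S : sup_witnessed S -> S !=set0 -> S (sup S).
Proof.
move=> wS S0.
have [m Sm ubm] : has_greatest S.
  have [/finite_has_greatest|/wS //] := pselect (finite_set S); exact.
suff -> : sup S = m by [].
apply/le_anti; rewrite ge_sup //=.
by apply: ub_le_sup => //; exists m.
Qed.

Lemma imp_le_imp p p' q : p' <= p -> q <= 1 -> god_imp p q <= god_imp p' q.
Proof.
rewrite /god_imp => p'p q1; case: (leP p q) => pq; first by rewrite (le_trans p'p pq).
by case: ifP.
Qed.

(** If the values differed, the implication from the larger to the smaller would equal the smaller
    one, which is below 1. This turns the bisimulation conditions on concept names and on [Self]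
    into equalities. *)
Lemma iff_ge1_eq p q :
  0 <= p <= 1 -> 0 <= q <= 1 -> 1 <= god_iff p q -> p = q.
Proof.
move=> /andP[_ p1] /andP[_ q1].
rewrite /god_iff /god_and /god_imp le_min => /andP[].
case: (ltgtP p q) => // pq.
- by move=> _ /(le_trans q1) /le_lt_trans /(_ pq); rewrite ltxx.
- by move=> /(le_trans p1) /le_lt_trans /(_ pq); rewrite ltxx.
Qed.

Lemma iff_sym p q : god_iff p q = god_iff q p.
Proof. exact: minC. Qed.

Lemma and_truel p : p <= 1 -> god_and true%:R p = p.
Proof. exact: min_r. Qed.

(** This decodes the right-hand sides of the bisimulation conditions: a positive lower bound
    excludes the value 0 of the boolean factor, so the points are related. *)
Lemma lt0_le_and (b : bool) p v :
  0 < v -> v <= god_and b%:R p -> b /\ v <= p.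
Proof.
move=> v0; rewrite /god_and le_min => /andP[vb vp]; split=> //.
by case: b vb => // /(lt_le_trans v0); rewrite ltxx.
Qed.

End UnitInterval.

(** * Forward simulation of fuzzy relations, closed under union, composition and iteration *)

Section Simulation.
Variables (K : realType) (D D' : Type) (Z : D -> D' -> bool).

Definition simulates (F : D -> D -> K) (F' : D' -> D' -> K) : Prop := forall x x' y,
  Z x x' -> 0 < F x y -> exists2 y', Z y y' & F x y <= F' x' y'.

Lemma simulates_or F F' G G' : simulates F F' -> simulates G G' ->
  simulates (fun x y => god_or (F x y) (G x y))
            (fun x y => god_or (F' x y) (G' x y)).
Proof.
move=> sF sG x x' y Zx; rewrite /god_or.
case: (leP (F x y) (G x y)) => _ pos.
  by have [y' Zy le] := sG _ _ _ Zx pos; exists y' => //; rewrite le_max le orbT.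
by have [y' Zy le] := sF _ _ _ Zx pos; exists y' => //; rewrite le_max le.
Qed.

Lemma simulates_comp F F' G G' :
  (forall x y, 0 <= F' x y <= 1) -> (forall x y, 0 <= G' x y <= 1) ->
  (forall x y, sup_witnessed (comp_values F G x y)) ->
  simulates F F' -> simulates G G' ->
  simulates (fun x y => sup (comp_values F G x y))
            (fun x y => sup (comp_values F' G' x y)).
Proof.
move=> F01 G01 w sF sG x x' y Zx.
(* A single midpoint [z] carries the whole value. Since the minimum at [z] is positive, so are both
   factors, and the two simulations can be chained. *)
have [z ->] : comp_values F G x y (sup (comp_values F G x y)).
  by apply: sup_witnessed_mem => //; exists (god_and (F x x) (G x y)); exists x.
rewrite /god_and lt_min => /andP[Fp Gp].
have [z' Zz leF] := sF _ _ _ Zx Fp.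
have [y' Zy leG] := sG _ _ _ Zz Gp.
exists y' => //; apply: le_trans (le_min2 leF leG) _.
by apply: unit_le_sup => [v [u ->]|]; [exact: unit_and | exists z'].
Qed.

(** One sequence [u'] is built for the whole of [u], and it matches every initial segment of [u]
    whose edges are all positive. *)
Lemma simulates_path F F' (u : nat -> D) x' : simulates F F' -> Z (u 0) x' ->
  exists2 u' : nat -> D', u' 0 = x' & forall n,
    (forall i, (i < n)%N -> 0 < F (u i) (u i.+1)) ->
    Z (u n) (u' n) /\
    forall i, (i < n)%N -> F (u i) (u i.+1) <= F' (u' i) (u' i.+1).
Proof.
move=> sF Z0.
(* A triple consists of the current point, its partner and the next point. Keeping the premises
   inside the existential makes the choice function total; when they fail, any value will do and
   [z'] is returned. *)
have /choice[g gP] : forall t : D * D' * D, exists y', Z t.1.1 t.1.2 ->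
    0 < F t.1.1 t.2 -> Z t.2 y' /\ F t.1.1 t.2 <= F' t.1.2 y'.
  move=> [[x z'] y] /=.
  have [[Zx pos]|npos] := pselect (Z x z' /\ 0 < F x y).
    by have [y' Zy le] := sF _ _ _ Zx pos; exists y'.
  by exists z' => Zx pos; case: npos.
exists (nat_rect (fun _ => D') x' (fun n v => g (u n, v, u n.+1))) => //.
elim=> [//|n IH] pos.
have [|Zn le] := IH; first by move=> i ilt; apply: pos; rewrite ltnS ltnW.
have [Zn1 len] := gP (u n, _, u n.+1) Zn (pos _ (ltnSn n)).
split=> // i; rewrite ltnS leq_eqVlt => /predU1P[->|/le //].
exact: len.
Qed.

Lemma simulates_star F F' :
  (forall x y, 0 <= F' x y <= 1) ->
  (forall x y, sup_witnessed (star_values F x y)) ->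
  simulates F F' ->
  simulates (fun x y => sup (star_values F x y))
            (fun x y => sup (star_values F' x y)).
Proof.
move=> F01 w sF x x' y Zx.
(* An empty set of values would have supremum 0, against the positivity assumed in a simulation. *)
have [->|/set0P S0] := eqVneq (star_values F x y) set0.
  by rewrite sup0 ltxx.
have [n [u [ux uy ->]]] := sup_witnessed_mem (w x y) S0.
move=> pos; rewrite -{}ux in Zx.
have [u' u'0 /(_ n)[i lti|Zn le]] := simulates_path sF Zx.
  exact: lt_le_trans pos (bigand_le _ (Ordinal lti)).
exists (u' n); first by rewrite -uy.
apply: (@le_trans _ _ (god_bigand (fun i : 'I_n => F' (u' i) (u' i.+1)))).
  apply: le_bigand; first exact: bigand_le1.
  by move=> i; apply: le_trans (bigand_le _ i) (le _ (ltn_ord i)).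
apply: unit_le_sup => [v [m [t [_ _ ->]]]|]; first by apply: unit_bigand.
by exists n, u'.
Qed.

End Simulation.

(** * Transposes of compositions and iterations *)

Section Transposition.
Variables (K : realType) (D : Type).
Implicit Types (F G : D -> D -> K).

Lemma comp_values_tr F G x y :
  comp_values F G x y = comp_values (fun a b => G b a) (fun a b => F b a) y x.
Proof. by apply/seteqP; split=> v [z ->]; exists z; rewrite /god_and minC. Qed.

(** A path is read backwards: edge [i] of the reversed path is edge [rev_ord i] of the original one,
    taken in the opposite direction. *)
Lemma star_values_tr_sub F x y : star_values F x y `<=` star_values (fun a b => F b a) y x.
Proof.
move=> v [n [u [ux uy ->]]]; exists n, (fun i => u (n - i)%N).
split; rewrite ?subn0 ?subnn //.
pose f (i : 'I_n) := F (u i) (u i.+1).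
have -> : (fun i : 'I_n => F (u (n - i.+1)%N) (u (n - i)%N))
    = fun i => f (rev_ord i).
  by apply/funext => i; rewrite /f /= subnSK.
have fE : (fun i => f (rev_ord (rev_ord i))) = f.
  by apply/funext => i; rewrite rev_ordK.
(* As [rev_ord] is an involution, each of the two minima is a reindexing of the other. *)
apply/le_anti; rewrite (bigand_le_comp f) /=.
by have := bigand_le_comp (fun i => f (rev_ord i)) (@rev_ord n); rewrite fE.
Qed.

(** The second inclusion is the first one for the transpose of [F], since transposing twice gives
    back [F]. *)
Lemma star_values_tr F x y : star_values F x y = star_values (fun a b => F b a) y x.
Proof. by apply/seteqP; split; exact: star_values_tr_sub. Qed.

End Transposition.

(* Roles and concepts take values in the unit interval *)
Scheme role_concept_ind := Induction for role Sort Prop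
  with concept_role_ind := Induction for concept Sort Prop.
Combined Scheme role_concept_mutind from role_concept_ind, concept_role_ind.

(** A Gödel implication is 1 or equals its conclusion, and the conclusion here is 0 or 1. *)
Lemma lt_values01 (K : realType) (D : Type) n (F : D -> D -> K) (H : D -> K) x v :
  lt_values n F H x v -> 0 <= v <= 1.
Proof.
by move=> [y ->]; apply: unit_imp; case: ifP; rewrite ler01 lexx.
Qed.

Section UnitValued.
Variables (K : realType) (CN RN IN : Type) (Phi : set feature).
Variable I : interp K CN RN IN.

Lemma basicI01 (R : basic_role RN Phi) x y : 0 <= basicI I R x y <= 1.
Proof. by case: R => [r|hI r]; exact: rnameI01. Qed.

Lemma ge_values01 n (R : basic_role RN Phi) (H : dom I -> K) x v :
  (forall x, 0 <= H x <= 1) -> ge_values n (basicI I R) H x v -> 0 <= v <= 1.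
Proof.
move=> H01 [y [yinj ->]]; apply: unit_bigand => i.
by apply: unit_and => //; exact: basicI01.
Qed.

Lemma interp01 :
  (forall (R : role K CN RN IN Phi) x y, 0 <= roleI I R x y <= 1) /\
  (forall (C : concept K CN RN IN Phi) x, 0 <= conceptI I C x <= 1).
Proof.
have c01 (b : bool) : 0 <= (if b then 1 else 0 : K) <= 1.
  by case: b; rewrite ler01 lexx.
have one01 (x : dom I) : 0 <= (1 : K) <= 1 by rewrite ler01 lexx.
apply: (@role_concept_mutind K CN RN IN Phi) => /=.
- by move=> r x y; exact: rnameI01.
- by move=> R R01 S S01 x y; apply: unit_sup => v [z ->]; exact: unit_and.
- by move=> R R01 S S01 x y; exact: unit_or.
- by move=> R R01 x y; apply: unit_sup => v [n [u [_ _ ->]]]; exact: unit_bigand.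
- by move=> C C01 x y; case: ifP => // _; rewrite lexx ler01.
- by move=> _ R R01 x y.
- by move=> _ x y; rewrite ler01 lexx.
- by move=> p p01 x.
- by move=> A x; exact: cnameI01.
- by move=> C C01 E E01 x; exact: unit_and.
- by move=> C C01 E E01 x; exact: unit_imp.
- by move=> C C01 x; exact: unit_neg.
- by move=> C C01 E E01 x; exact: unit_or.
- by move=> C C01 x; exact: unit_onem.
- by move=> R R01 C C01 x; apply: unit_inf => v [y ->]; exact: unit_imp.
- by move=> R R01 C C01 x; apply: unit_sup => v [y ->]; exact: unit_and.
- by move=> _ a x.
- by move=> _ r x; exact: rnameI01.
- by move=> n _ R C C01 x; apply: unit_sup => v; exact: ge_values01.
- by move=> n _ R C C01 x; apply: unit_inf => v; exact: lt_values01.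
- by move=> n _ R x; apply: unit_sup => v; exact: ge_values01.
- by move=> n _ R x; apply: unit_inf => v; exact: lt_values01.
Qed.

Lemma roleI01 (R : role K CN RN IN Phi) x y : 0 <= roleI I R x y <= 1.
Proof. exact: interp01.1. Qed.

Lemma conceptI01 (C : concept K CN RN IN Phi) x : 0 <= conceptI I C x <= 1.
Proof. exact: interp01.2. Qed.

End UnitValued.

(** * Comparison of number restrictions *)

Section NumberRestrictions.
Variables (K : realType) (D D' : Type) (n : nat).
Variables (F : D -> D -> K) (H : D -> K) (x : D).
Variables (F' : D' -> D' -> K) (H' : D' -> K) (x' : D').

(** Both counting conditions of a bisimulation are brought to this form, the unqualified one with
    [H] and [H'] constantly 1, so that each kind of number restriction is compared only once. *)
Definition counts_below : Prop :=
  forall y : 'I_n -> D, injective y ->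
    (forall i, 0 < god_and (F x (y i)) (H (y i))) ->
  exists2 y' : 'I_n -> D', injective y' &
    god_bigand (fun i => god_and (F x (y i)) (H (y i)))
      <= god_bigand (fun i => god_and (F' x' (y' i)) (H' (y' i))).

Lemma counts_below_ge :
  (forall v, ge_values n F' H' x' v -> 0 <= v <= 1) ->
  counts_below -> sup (ge_values n F H x) <= sup (ge_values n F' H' x').
Proof.
move=> v01 cb; have /andP[s0 _] := unit_sup v01.
have [->|/set0P S0] := eqVneq (ge_values n F H x) set0; first by rewrite sup0.
(* A value exceeding the target supremum is positive, because that supremum is at least 0 even over
   an empty set. All components of the tuple are then positive and the tuple can be transferred. *)
apply: ge_sup => // v [y [yinj ->]]; rewrite leNgt; apply/negP => lt.
have pos i : 0 < god_and (F x (y i)) (H (y i)).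
  exact: lt_le_trans (le_lt_trans s0 lt) (bigand_le _ i).
have [y' y'inj le] := cb y yinj pos.
move: lt; apply/negP; rewrite -leNgt; apply: le_trans le _.
by apply: unit_le_sup => //; exists y'.
Qed.

End NumberRestrictions.

Lemma has_repetitionPn (D : Type) n (y : 'I_n -> D) :
  ~ has_repetition y <-> injective y.
Proof.
split=> [nrep i j yij|yinj [j [k [jk /yinj ejk]]]]; last first.
  by move: jk; rewrite ejk ltnn.
apply/val_inj; case: (ltngtP i j) => // ij; case: nrep.
  by exists i, j.
by exists j, i.
Qed.

(** The premise runs from [x'] to [x], against the inequality. A tuple at [x'] contributes 1 unless
    it is injective with positive minimum, when it contributes 0; in that case the premise yields an
    injective tuple at [x] with positive minimum, so the infimum at [x] is at most 0 as well. *)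
Lemma counts_below_lt (K : realType) (D D' : Type) n
    (F : D -> D -> K) (H : D -> K) (x : D)
    (F' : D' -> D' -> K) (H' : D' -> K) (x' : D') :
  counts_below n F' H' x' F H x ->
  inf (lt_values n F H x) <= inf (lt_values n F' H' x').
Proof.
move=> cb.
have inf1 : inf (lt_values n F H x) <= 1.
  by have /andP[] := unit_inf (@lt_values01 _ _ n F H x).
apply: lb_le_inf; first by eexists; exists (fun=> x').
move=> _ [y' ->].
case: asboolP => [_|/has_repetitionPn y'inj]; rewrite /god_imp.
  by rewrite bigand_le1.
case: ifPn => //; rewrite -ltNge => pos.
have pos' i : 0 < god_and (F' x' (y' i)) (H' (y' i)).
  exact: lt_le_trans pos (bigand_le _ i).
have [y yinj le] := cb y' y'inj pos'.
apply: unit_inf_le => [v|]; first exact: lt_values01.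
exists y; rewrite asboolF; last by apply/has_repetitionPn.
by rewrite /god_imp leNgt (lt_le_trans pos le).
Qed.

(** * Invariance of roles and concepts under witnessed bisimulations *)

Section Invariance.
Variables (K : realType) (CN RN IN : Type) (Phi : set feature).
Implicit Types I : interp K CN RN IN.

Definition witnessed_bisimulation I I' (Z : dom I -> dom I' -> bool) : Prop :=
  [/\ witnessed Phi I, witnessed Phi I' & crisp_bisimulation Phi Z].

Lemma witnessed_bisimulation_sym I I' (Z : dom I -> dom I' -> bool) :
  witnessed_bisimulation Z -> witnessed_bisimulation (fun x' x => Z x x').
Proof.
case=> wI wI' [bA bF bB bO bUf bUb bS bQf bQb bNf bNb]; split=> //.
split=> //.
- by move=> x x' A; rewrite iff_sym.
- by move=> O x x' a xx'; apply: (bO O x' x a); case: xx' => -[? ?]; [right | left].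
- by move=> O x x'; exact: bUb.
- by move=> O x x'; exact: bUf.
- by move=> S x x' r; rewrite iff_sym; exact: bS.
- by move=> n Q x x'; exact: bQb.
- by move=> n Q x x'; exact: bQf.
- by move=> n Q x x'; exact: bNb.
- by move=> n Q x x'; exact: bNf.
Qed.

(** The clause on transposes is conditional because, for a role name, it rests on the bisimulation
    condition for the inverse name, a basic role only when [Phi feat_I] holds. *)
Definition simulated_role (R : role K CN RN IN Phi) : Prop :=
  forall I I' (Z : dom I -> dom I' -> bool), witnessed_bisimulation Z ->
  simulates Z (roleI I R) (roleI I' R) /\
  (Phi feat_I -> simulates Z (fun x y => roleI I R y x)
                             (fun x y => roleI I' R y x)).

Definition invariant_concept (C : concept K CN RN IN Phi) : Prop :=
  forall I I' (Z : dom I -> dom I' -> bool), witnessed_bisimulation Z ->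
  forall x x', Z x x' -> conceptI I C x = conceptI I' C x'.

(** The reverse inequality is the hypothesis applied to the converse of [Z]. *)
Lemma le_invariant_concept C :
  (forall I I' (Z : dom I -> dom I' -> bool), witnessed_bisimulation Z ->
    forall x x', Z x x' -> conceptI I C x <= conceptI I' C x') ->
  invariant_concept C.
Proof.
move=> leC I I' Z bZ x x' Zx; apply/le_anti/andP; split.
  exact: leC bZ _ _ Zx.
exact: leC (witnessed_bisimulation_sym bZ) _ _ Zx.
Qed.

Lemma nominal_iff I I' (Z : dom I -> dom I' -> bool) x x' a :
  crisp_bisimulation Phi Z -> Phi feat_O -> Z x x' ->
  (x = indI I a) = (x' = indI I' a).
Proof.
move=> bZ hO Zx; apply/propext; split=> ex.
  apply: contrapT => nx'; move: Zx.
  by rewrite (bis_O bZ hO (a := a)) //; left.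
apply: contrapT => nx; move: Zx.
by rewrite (bis_O bZ hO (a := a)) //; right.
Qed.

Lemma basic_simulates I I' (Z : dom I -> dom I' -> bool) :
  witnessed_bisimulation Z ->
  forall R : basic_role RN Phi, simulates Z (basicI I R) (basicI I' R).
Proof.
case=> _ _ bZ R x x' y Zx pos.
have [y'] := bis_forth bZ x x' R y.
rewrite Zx and_truel; last by case/andP: (basicI01 R x y).
by move=> /(lt0_le_and pos)[Zy le]; exists y'.
Qed.

(** Each [y' i] has some related [y j], and different [i] may share the same [j]: the value of [C]
    at [y' i] is that at [y j], which already bounds the combined minimum from above. *)
Lemma counts_below_Q I I' (Z : dom I -> dom I' -> bool) n
    (R : basic_role RN Phi) (C : concept K CN RN IN Phi) x x' :
  witnessed_bisimulation Z -> invariant_concept C -> Phi (feat_Q n) ->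
  Z x x' ->
  counts_below n (basicI I R) (conceptI I C) x
                 (basicI I' R) (conceptI I' C) x'.
Proof.
move=> bZ invC Q Zx y yinj pos; have [_ _ cZ] := bZ.
have posR j : 0 < basicI I R x (y j).
  by have := pos j; rewrite /god_and lt_min => /andP[].
have [y' [y'inj ley']] := bis_Q_forth cZ Q Zx yinj posR.
exists y' => //; apply: le_bigand; first exact: bigand_le1.
move=> i; have [j] := ley' i.
rewrite Zx and_truel ?bigand_le1 // => le.
(* The minimum of the role values alone must be positive for the inequality [le] to imply that [y j]
   and [y' i] are related. *)
have lo : 0 < god_bigand (fun k => basicI I R x (y k)).
  by apply/lt_bigmin.
have [Zy leR] := lt0_le_and lo le.
rewrite /god_and le_min -(invC _ _ _ bZ _ _ Zy); apply/andP; split.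
  apply: le_trans leR; apply: le_bigand; first exact: bigand_le1.
  move=> k; apply: le_trans (bigand_le _ k) _.
  by rewrite ge_min lexx.
by apply: le_trans (bigand_le _ j) _; rewrite ge_min lexx orbT.
Qed.

Lemma counts_below_N I I' (Z : dom I -> dom I' -> bool) n
    (R : basic_role RN Phi) x x' :
  witnessed_bisimulation Z -> Phi (feat_N n) -> Z x x' ->
  counts_below n (basicI I R) (fun=> 1) x (basicI I' R) (fun=> 1) x'.
Proof.
move=> bZ N Zx y yinj pos; have [_ _ cZ] := bZ.
have posR j : 0 < basicI I R x (y j).
  by have := pos j; rewrite /god_and lt_min => /andP[].
have [y' [y'inj ley']] := bis_N_forth cZ N Zx yinj posR.
exists y' => //; apply: le_bigand; first exact: bigand_le1.
move=> i; have := ley' i; rewrite Zx and_truel ?bigand_le1 // => le.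
rewrite /god_and le_min bigand_le1 andbT; apply: le_trans le.
apply: le_bigand; first exact: bigand_le1.
by move=> k; apply: le_trans (bigand_le _ k) _; rewrite ge_min lexx.
Qed.

Lemma exists_le I I' (Z : dom I -> dom I' -> bool) R C x x' :
  witnessed_bisimulation Z -> simulated_role R -> invariant_concept C ->
  Z x x' -> conceptI I (CExists R C) x <= conceptI I' (CExists R C) x'.
Proof.
move=> bZ simR invC Zx /=; have [sR _] := simR _ _ _ bZ.
have u01 v : exists_values (roleI I' R) (conceptI I' C) x' v -> 0 <= v <= 1.
  by move=> [y' ->]; apply: unit_and; [exact: roleI01 | exact: conceptI01].
apply: ge_sup; first by eexists; exists x.
(* Points at role value 0 have no guaranteed partner, but they contribute at most 0 to the
   supremum. *)
move=> _ [y ->]; have [R0|pos] := leP (roleI I R x y) 0.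
  apply: (@le_trans _ _ 0); first by rewrite ge_min R0.
  by case/andP: (unit_sup u01).
have [y' Zy le] := sR _ _ _ Zx pos.
rewrite (invC _ _ _ bZ _ _ Zy).
apply: (le_trans (le_min2 le (lexx _))).
by apply: unit_le_sup => //; exists y'.
Qed.

(** The role is simulated along the converse of [Z]: a partner [y] of [y'] has the same value of [C]
    and at least the same role value, and implication is antitone in its premise. At role value 0
    the implication is 1. *)
Lemma forall_le I I' (Z : dom I -> dom I' -> bool) R C x x' :
  witnessed_bisimulation Z -> simulated_role R -> invariant_concept C ->
  Z x x' -> conceptI I (CForall R C) x <= conceptI I' (CForall R C) x'.
Proof.
move=> bZ simR invC Zx /=.
have [sR _] := simR _ _ _ (witnessed_bisimulation_sym bZ).
have u01 v : forall_values (roleI I R) (conceptI I C) x v -> 0 <= v <= 1.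
  by move=> [y ->]; apply: unit_imp; exact: conceptI01.
apply: lb_le_inf; first by eexists; exists x'.
move=> _ [y' ->]; have [R0|pos] := leP (roleI I' R x' y') 0.
  rewrite /god_imp (le_trans R0); last by case/andP: (conceptI01 C y').
  by case/andP: (unit_inf u01).
have [y Zy le] := sR _ _ _ Zx pos.
rewrite -(invC _ _ _ bZ _ _ Zy).
apply: (@le_trans _ _ (god_imp (roleI I R x y) (conceptI I C y))).
  by apply: unit_inf_le => //; exists y.
by apply: imp_le_imp => //; case/andP: (conceptI01 C y).
Qed.

Lemma bisimulation_invariance :
  (forall R, simulated_role R) /\ (forall C, invariant_concept C).
Proof.
apply: (@role_concept_mutind K CN RN IN Phi).
- move=> r I I' Z bZ; split=> [|hI].
    exact: basic_simulates bZ (BName Phi r).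
  exact: basic_simulates bZ (BInv hI r).
- move=> R sR S sS I I' Z bZ; have [wI _ _] := bZ.
  have [[fR bR] [fS bS]] := (sR _ _ _ bZ, sS _ _ _ bZ).
  split=> [|hI].
    apply: simulates_comp => //; try exact: roleI01.
    exact: wit_comp wI _ _.
  (* The transpose of a composition is the composition of the transposes in the opposite order, so
     the closure lemma applies again, with attainment carried over from the untransposed set. *)
  have trE J : (fun x y => roleI J (RComp R S) y x) =
      (fun x y => sup (comp_values (fun a b => roleI J S b a)
                                   (fun a b => roleI J R b a) x y)).
    by apply/funext => x; apply/funext => y; rewrite /= comp_values_tr.
  rewrite !{}trE; apply: simulates_comp; try by move=> *; exact: roleI01.
  + by move=> x y; rewrite -comp_values_tr; exact: wit_comp wI _ _ _ _.
  + exact: bS.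
  + exact: bR.
- move=> R sR S sS I I' Z bZ.
  have [[fR bR] [fS bS]] := (sR _ _ _ bZ, sS _ _ _ bZ).
  split=> [|hI]; first exact: simulates_or.
  by apply: simulates_or; [exact: bR | exact: bS].
- move=> R sR I I' Z bZ; have [wI _ _] := bZ; have [fR bR] := sR _ _ _ bZ.
  split=> [|hI].
    apply: simulates_star => //; try exact: roleI01.
    exact: wit_star wI _.
  have trE J : (fun x y => roleI J (RStar R) y x) =
      (fun x y => sup (star_values (fun a b => roleI J R b a) x y)).
    by apply/funext => x; apply/funext => y; rewrite /= star_values_tr.
  rewrite !{}trE; apply: simulates_star; try by move=> *; exact: roleI01.
  + by move=> x y; rewrite -star_values_tr; exact: wit_star wI _ _ _.
  + exact: bR.
- move=> C iC I I' Z bZ.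
  (* A test is positive only on the diagonal, so [x'] is its own successor and one witness serves
     both the role and its transpose. *)
  have test x x' : Z x x' -> 0 < conceptI I C x ->
      exists2 y', Z x y' & conceptI I C x <= roleI I' (RTest C) x' y' /\
                           conceptI I C x <= roleI I' (RTest C) y' x'.
    move=> Zx pos; exists x' => //=.
    by rewrite asboolT // (iC _ _ _ bZ _ _ Zx) lexx.
  split=> [|_] x x' y Zx /=; case: asboolP => [e|_]; rewrite ?ltxx //.
    by rewrite -e => /(test _ _ Zx) [y' Zy [le _]]; exists y'.
  by rewrite e => /(test _ _ Zx) [y' Zy [_ le]]; exists y'.
- move=> hI R sR I I' Z bZ; have [fR bR] := sR _ _ _ bZ.
  (* Inversion exchanges the two clauses of the induction hypothesis. *)
  by split=> [|_]; [exact: bR | exact: fR].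
- move=> hU I I' Z [_ _ bZ]; have univ : simulates Z (fun _ _ => 1 : K) (fun _ _ => 1).
    move=> x x' y Zx pos; have [y'] := bis_U_forth bZ hU x x' y.
    rewrite Zx; case Zy: (Z y y'); last by rewrite lt_geF.
    by exists y'.
  by split.
- by move=> p p01 I I' Z bZ.
- move=> A I I' Z [_ _ bZ] x x' Zx /=; apply: iff_ge1_eq; try exact: cnameI01.
  by have := bis_name bZ x x' A; rewrite Zx.
- move=> C iC E iE I I' Z bZ x x' Zx /=.
  by rewrite (iC _ _ _ bZ _ _ Zx) (iE _ _ _ bZ _ _ Zx).
- move=> C iC E iE I I' Z bZ x x' Zx /=.
  by rewrite (iC _ _ _ bZ _ _ Zx) (iE _ _ _ bZ _ _ Zx).
- by move=> C iC I I' Z bZ x x' Zx /=; rewrite (iC _ _ _ bZ _ _ Zx).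
- move=> C iC E iE I I' Z bZ x x' Zx /=.
  by rewrite (iC _ _ _ bZ _ _ Zx) (iE _ _ _ bZ _ _ Zx).
- by move=> C iC I I' Z bZ x x' Zx /=; rewrite (iC _ _ _ bZ _ _ Zx).
- move=> R sR C iC; apply: le_invariant_concept => I I' Z bZ x x'.
  exact: forall_le.
- move=> R sR C iC; apply: le_invariant_concept => I I' Z bZ x x'.
  exact: exists_le.
- move=> hO a I I' Z [_ _ bZ] x x' Zx /=.
  suff -> : (x = indI I a) = (x' = indI I' a) by [].
  exact: nominal_iff bZ hO Zx.
- move=> hS r I I' Z [_ _ bZ] x x' Zx /=; apply: iff_ge1_eq; try exact: rnameI01.
  by have := bis_Self bZ hS x x' r; rewrite Zx.
- move=> n Q R C iC; apply: le_invariant_concept => I I' Z bZ x x' Zx /=.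
  apply: counts_below_ge; last exact: counts_below_Q bZ iC Q Zx.
  by move=> v; apply: ge_values01 => y; exact: conceptI01.
- move=> n Q R C iC; apply: le_invariant_concept => I I' Z bZ x x' Zx /=.
  apply: counts_below_lt.
  (* Upper bounds on counting are compared by transferring tuples backwards, hence along the
     converse of [Z]. *)
  exact: counts_below_Q (witnessed_bisimulation_sym bZ) iC Q Zx.
- move=> n N R; apply: le_invariant_concept => I I' Z bZ x x' Zx /=.
  apply: counts_below_ge; last exact: counts_below_N bZ N Zx.
  by move=> v; apply: ge_values01 => y; rewrite ler01 lexx.
- move=> n N R; apply: le_invariant_concept => I I' Z bZ x x' Zx /=.
  apply: counts_below_lt.
  exact: counts_below_N (witnessed_bisimulation_sym bZ) N Zx.
Qed.

(** * Transfer of assertions and of ABoxes *)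

Lemma role_le I I' (Z : dom I -> dom I' -> bool) (R : role K CN RN IN Phi) a b :
  Phi feat_O -> witnessed_bisimulation Z ->
  (forall c, Z (indI I c) (indI I' c)) ->
  roleI I R (indI I a) (indI I b) <= roleI I' R (indI I' a) (indI I' b).
Proof.
move=> hO bZ Zind; have [R0|pos] := leP (roleI I R (indI I a) (indI I b)) 0.
  by apply: (le_trans R0); case/andP: (roleI01 R (indI I' a) (indI I' b)).
have [sR _] := bisimulation_invariance.1 R _ _ _ bZ.
have [y' Zy le] := sR _ _ _ (Zind a) pos.
have [_ _ cZ] := bZ.
(* The simulation provides only some partner [y'] of the point named [b]; the nominal condition
   identifies it with the point named [b] in [I']. *)
by have := nominal_iff b cZ hO Zy; rewrite propeqE => -[/(_ erefl) <- _].
Qed.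

Lemma validates_bisimilar I I' (Z : dom I -> dom I' -> bool)
    (phi : assertion K CN RN IN Phi) :
  Phi feat_O \/ is_concept_assertion phi -> witnessed_bisimulation Z ->
  (forall a, Z (indI I a) (indI I' a)) ->
  validates I phi -> validates I' phi.
Proof.
move=> hO bZ Zind; have [_ _ cZ] := bZ.
have sO : ~ is_concept_assertion phi -> Phi feat_O by case: hO.
have named a b : Phi feat_O -> (indI I a = indI I b) = (indI I' a = indI I' b).
  by move=> O; exact: nominal_iff b cZ O (Zind a).
case: phi {hO} sO => [a b|a b|C a c p p01|R a b c p p01] /= sO.
- by rewrite named //; exact: sO.
- by rewrite named //; exact: sO.
- by rewrite (bisimulation_invariance.2 C _ _ _ bZ _ _ (Zind a)).
- suff -> : roleI I R (indI I a) (indI I b) = roleI I' R (indI I' a) (indI I' b).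
    by [].
  have O : Phi feat_O by exact: sO.
  apply/le_anti; rewrite (role_le _ _ _ O bZ Zind).
  exact: role_le O (witnessed_bisimulation_sym bZ) Zind.
Qed.

End Invariance.

Theorem theorem8 (K : realType) (CN RN IN : Type) (Phi : set feature)
    (Phi_features : Phi `<=` features)
    (A : fuzzy_abox K CN RN IN Phi)
    (hA : Phi feat_O \/
          forall phi : assertion K CN RN IN Phi,
            abox_set A phi -> is_concept_assertion phi)
    (I I' : interp K CN RN IN)
    (wI : witnessed Phi I) (wI' : witnessed Phi I')
    (bis : strongly_bisimilar Phi I I') :
  models I A <-> models I' A.
Proof.
have [_ [Z cZ Zind]] := bis.
have bZ : witnessed_bisimulation Phi Z by [].
have hO phi : abox_set A phi -> Phi feat_O \/ is_concept_assertion phi.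
  by case: hA => [O _|cA Aphi]; [left | right; exact: cA].
split=> mA phi Aphi.
  exact: validates_bisimilar (hO _ Aphi) bZ Zind (mA _ Aphi).
exact: validates_bisimilar (hO _ Aphi) (witnessed_bisimulation_sym bZ) Zind
  (mA _ Aphi).
Qed.
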